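(* Let $P$ be the probability measure on $\{1,2,3,4,5,6\}\subset\mathbb{R}$ with probability mass function $f(j)=2^{-j}$ for $j\in\{1,2,3,4,5\}$ and $f(6)=2^{-5}$. The optimal set of two-means for $P$ is $\{a[1,2],a[3,6]\}$, with quantization error $V_2(P)=\frac{341}{768}$.
   Context: For a Borel probability measure $P$ on $\mathbb{R}$ and a nonempty finite set $\alpha\subset\mathbb{R}$, the distortion error is $V(P;\alpha)=\int\min_{a\in\alpha}|x-a|^2\,dP(x)$. The $n$th quantization error is $V_n(P)=\inf\{V(P;\alpha):\alpha\subset\mathbb{R},\ 1\le\mathrm{card}(\alpha)\le n\}$, and a set $\alpha$ with $1\le\mathrm{card}(\alpha)\le n$ attaining this infimum is called an optimal set of $n$-means for $P$. For $i\le j$ in $\{1,\dots,6\}$, $a[i,j]=\dfrac{\sum_{k=i}^{j}k f(k)}{\sum_{k=i}^{j}f(k)}$. *)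

(* Defs.v *)
From HB Require Import structures.
From mathcomp Require Import all_boot all_order all_algebra finmap ring lra.
From mathcomp Require Import mathcomp_extra boolp classical_sets functions reals.
From mathcomp Require Import interval_inference ereal topology normedtype.
From mathcomp Require Import measure lebesgue_measure lebesgue_integral.

Set Implicit Arguments.
Unset Strict Implicit.
Unset Printing Implicit Defensive.

Import Order.TTheory GRing.Theory Num.Theory.
Import numFieldNormedType.Exports.

Local Open Scope classical_set_scope.
Local Open Scope fset_scope.
Local Open Scope ring_scope.

Section quantization.
Context {R : realType}.
Implicit Types (P : probability (measurableTypeR R) R) (alpha : {fset R}).

(* The neutral element +oo makes the iterated minimum the usual minimum as soon
   as alpha is nonempty. *)
Definition distortion P alpha : \bar R :=
  (\int[P]_x \big[Order.min/+oo]_(a <- alpha) (`|(x : R) - a| ^+ 2)%:E)%E.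

Definition admissible (n : nat) alpha : Prop := (1 <= #|` alpha| <= n)%N.

Definition quantization_error (n : nat) P : \bar R :=
  ereal_inf [set distortion P alpha | alpha in admissible n].

Definition optimal_set (n : nat) P alpha : Prop :=
  admissible n alpha /\ distortion P alpha = quantization_error n P.

End quantization.

Section six_point_measure.
Variable R : realType.

Definition pmf (j : nat) : R :=
  if (1 <= j <= 5)%N then 2 ^- j else if j == 6 then 2 ^- 5 else 0.

Lemma pmf_ge0 j : 0 <= pmf j.
Proof.
by rewrite /pmf; case: ifP => _; [|case: ifP => _] => //;
  rewrite invr_ge0 exprn_ge0.
Qed.

Definition prob6_atom (k : nat) : {measure set (measurableTypeR R) -> \bar R} :=
  mscale (NngNum (pmf_ge0 k.+1)) (dirac (k.+1%:R : measurableTypeR R)).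

Definition prob6 : set (measurableTypeR R) -> \bar R := msum prob6_atom 6.

HB.instance Definition _ := Measure.on prob6.

Lemma prob6_setT : prob6 setT = 1%E.
Proof.
rewrite /prob6 /msum /prob6_atom /=.
rewrite (eq_bigr (fun k : 'I_6 => (pmf k.+1)%:E)); last first.
  by move=> k _; rewrite /mscale /= diracT mule1.
rewrite sumEFin; congr (_%:E).
rewrite !big_ord_recr big_ord0 /pmf /= !exprS expr0; by field.
Qed.

HB.instance Definition _ := @Measure_isProbability.Build _ _ R prob6 prob6_setT.

Lemma prob6_set1 (j : nat) : (1 <= j <= 6)%N -> prob6 [set j%:R] = (pmf j)%:E.
Proof.
case: j => // j; rewrite /= => j6; have {}j6 : (j < 6)%N by [].
rewrite /prob6 /msum /prob6_atom /= (bigD1 (Ordinal j6)) //= big1 ?adde0.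
  by rewrite /mscale /= diracE mem_set// mule1.
move=> k kj; rewrite /mscale /= diracE memNset ?mule0//= => /eqP.
by rewrite eqr_nat eqSS => /eqP kj'; case/eqP: kj; apply/val_inj.
Qed.

Definition centroid (i j : nat) : R :=
  (\sum_(i <= k < j.+1) k%:R * pmf k) / (\sum_(i <= k < j.+1) pmf k).

End six_point_measure.

Arguments pmf : clear implicits.
Arguments prob6 : clear implicits.
Arguments centroid : clear implicits.

(* Main.v *)
(* With two centers a <= b, the points 1, ..., 6 closer to a than to b form an
   initial segment {1, ..., t}, so the cost of (a, b) is one of seven quadratic
   polynomials.  Completing the square around the centroids of {1, ..., t} and
   {t + 1, ..., 6} bounds each of them from below; only t = 2 reaches 341/768,
   and only at the two centroids.  A single center counts as a = b. *)
Require Import Defs.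
From mathcomp Require Import all_boot all_order all_algebra finmap.
From mathcomp Require Import reals ereal measure lebesgue_measure.
From mathcomp Require Import ring lra boolp classical_sets.
From mathcomp Require Import measurable_realfun lebesgue_integral.

Import Order.TTheory GRing.Theory Num.Theory.

Local Open Scope fset_scope.
Local Open Scope ring_scope.

Section measurability.
Context {R : realType}.

Lemma bigmin_sqdist_ge0 (s : seq R) (x : R) :
  (0 <= \big[Order.min/+oo]_(a <- s) (`|x - a| ^+ 2)%:E)%E.
Proof.
elim/big_rec: _ => [|a y _ y0]; first exact: leey.
by rewrite le_min y0 lee_fin exprn_ge0.
Qed.

Lemma measurable_bigmin_sqdist (s : seq R) :
  measurable_fun setT (fun x : measurableTypeR R =>
    \big[Order.min/+oo%E]_(a <- s) (`|(x : R) - a| ^+ 2)%:E).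
Proof.
elim: s => [|a s IHs].
  by under eq_fun do rewrite big_nil; exact: measurable_cst.
under eq_fun do rewrite big_cons.
apply: measurable_mine => //; apply/measurable_EFinP.
apply: measurable_funX; apply: measurableT_comp => //.
exact: measurable_funB.
Qed.

End measurability.

(** Since $(x-b)^2-(x-a)^2=(b-a)(a+b-2x)$, the side of the midpoint on which [x] lies decides; at a
    tie the two squares agree. *)
Lemma min_sqdistE {R : realDomainType} (x a b : R) : a <= b ->
  Num.min ((x - a) ^+ 2) ((x - b) ^+ 2) =
  if x + x <= a + b then (x - a) ^+ 2 else (x - b) ^+ 2.
Proof.
move=> ab; case: (leP (x + x)) => xab.
  by rewrite min_l//; nra.
by rewrite min_r//; nra.
Qed.

Lemma ge0_integral_prob6 {R : realType} (f : measurableTypeR R -> \bar R) :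
  measurable_fun setT f -> (forall x, 0 <= f x)%E ->
  (\int[prob6 R]_x f x = \sum_(k < 6) (pmf R k.+1)%:E * f k.+1%:R)%E.
Proof.
move=> mf f0; rewrite ge0_integral_measure_sum//; apply: eq_bigr => k _.
rewrite ge0_integral_mscale//.
by rewrite (@integral_dirac _ (measurableTypeR R) k.+1%:R R)// diracT mul1e.
Qed.

Definition cost2 {R : realType} (a b : R) : R :=
  \sum_(k < 6)
    pmf R k.+1 * Num.min ((k.+1%:R - a) ^+ 2) ((k.+1%:R - b) ^+ 2).

Lemma distortion_prob6 {R : realType} (a b : R) :
  distortion (prob6 R) [fset a; b] = (cost2 a b)%:E.
Proof.
rewrite /distortion ge0_integral_prob6; first last.
- by move=> x; exact: bigmin_sqdist_ge0.
- exact: measurable_bigmin_sqdist.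
rewrite /cost2 -sumEFin; apply: eq_bigr => k _; rewrite EFinM; congr (_ * _)%E.
(* Coinciding centers collapse [[fset a; b]] to a singleton, which [big_fsetU1] cannot split. *)
have [<-|ab] := eqVneq a b.
  by rewrite fsetUid big_seq_fset1 minxx real_normK ?num_real.
rewrite big_fsetU1 ?inE//= big_seq_fset1 !real_normK ?num_real//.
by rewrite EFin_min.
Qed.

Lemma cost2_centroids {R : realType} :
  cost2 (4 / 3) (31 / 8) = 341 / 768 :> R.
Proof.
rewrite /cost2 !big_ord_recr big_ord0 /pmf /= !min_sqdistE; try lra.
(* The midpoint of the two centers is 125/48, between 2 and 3, so every test has a forced outcome
   and the other branches are contradictory. *)
by do 6![case: leP => ?]; lra.
Qed.

Lemma cost2_lower_bound {R : realType} (a b : R) : a <= b ->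
  (a = 4 / 3 /\ b = 31 / 8) \/ 341 / 768 < cost2 a b.
Proof.
move=> ab; rewrite /cost2 !big_ord_recr big_ord0 /pmf /= !min_sqdistE//.
have sq c x := sqr_ge0 (x - c : R).
(* The tests [k + k <= a + b] are monotone in k, so only 7 of the 64 outcomes are consistent;
   [exfalso; lra] discards the others as they arise. *)
case: ifP => [|/negbT]; rewrite -?ltNge => h1.
all: case: ifP => [|/negbT]; rewrite -?ltNge => h2; try by exfalso; lra.
all: case: ifP => [|/negbT]; rewrite -?ltNge => h3; try by exfalso; lra.
all: case: ifP => [|/negbT]; rewrite -?ltNge => h4; try by exfalso; lra.
all: case: ifP => [|/negbT]; rewrite -?ltNge => h5; try by exfalso; lra.
all: case: ifP => [|/negbT]; rewrite -?ltNge => h6; try by exfalso; lra.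
(* Each remaining quadratic is bounded on the whole plane. The goals come in the order t = 6, 5,
   ..., 0, and the constants are the centroids of the two clusters. *)
all: clear ab h1 h2 h3 h4 h5 h6.
- by right; have := sq (63 / 32) a; lra.
- by right; have := sq (57 / 31) a; have := sq 6 b; lra.
- by right; have := sq (26 / 15) a; have := sq (11 / 2) b; lra.
- by right; have := sq (11 / 7) a; have := sq (19 / 4) b; lra.
(* Here t = 2 and the minimum is exactly 341/768, so strictness has to come from a center that
   differs from its centroid. *)
- have sq_gt0 c x : x != c -> 0 < (x - c : R) ^+ 2.
    by move=> xc; rewrite exprn_even_gt0 ?subr_eq0 ?orbT.
  have [->|/sq_gt0 a_neq] := eqVneq a (4 / 3); last first.
    by right; have := sq (31 / 8) b; lra.
  have [->|/sq_gt0 b_neq] := eqVneq b (31 / 8); last by right; lra.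
  by left.
- by right; have := sq 1 a; have := sq (47 / 16) b; lra.
- by right; have := sq (63 / 32) b; lra.
Qed.

Lemma admissible2P {R : realType} (alpha : {fset R}) :
  admissible 2 alpha -> exists a b, a <= b /\ alpha = [fset a; b].
Proof.
have ordered (a b : R) : alpha = [fset a; b] ->
    exists a b, a <= b /\ alpha = [fset a; b].
  move=> ->; case: (leP a b) => [ab|/ltW ba]; first by exists a, b.
  by exists b, a; rewrite fsetUC.
rewrite /admissible; have [->|[a aA]] := fset_0Vmem alpha.
  by rewrite cardfs0.
(* Removing [a] leaves at most one point: either the second center, or nothing, and then [a] is
   doubled. *)
move=> /andP[_]; rewrite (cardfsD1 a) aA add1n ltnS leq_eqVlt ltnS leqn0.
rewrite cardfs_eq0 => /orP[/cardfs1P[b bA]|/eqP A0]; apply: ordered.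
  by rewrite -(fsetD1K aA) bA.
by rewrite -(fsetD1K aA) A0 fsetU0 -[LHS]fsetUid.
Qed.

Lemma centroid12 {R : realType} : centroid R 1 2 = 4 / 3.
Proof.
rewrite /centroid unlock /= /pmf /=. by field.
Qed.

Lemma centroid36 {R : realType} : centroid R 3 6 = 31 / 8.
Proof.
rewrite /centroid unlock /= /pmf /=. by field.
Qed.

Theorem proposition3p2 (R : realType) :
  (forall alpha : {fset R},
     optimal_set 2 (prob6 R) alpha <->
       alpha = [fset centroid R 1 2; centroid R 3 6]) /\
  quantization_error 2 (prob6 R) = (341 / 768 : R)%:E.
Proof.
rewrite centroid12 centroid36.
have optimum : distortion (prob6 R) [fset 4 / 3; 31 / 8] = (341 / 768 : R)%:E.
  by rewrite distortion_prob6 cost2_centroids.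
have admissible_opt : admissible 2 [fset (4 / 3 : R); 31 / 8].
  (* The cardinality is 1 or 2, and both are admissible. *)
  by rewrite /admissible cardfs2; case: (_ == _).
have V2 : quantization_error 2 (prob6 R) = (341 / 768 : R)%:E.
  apply/eqP; rewrite eq_le; apply/andP; split.
    by rewrite -optimum; apply: ereal_inf_lbound; exists [fset 4 / 3; 31 / 8].
  apply: le_ereal_inf_tmp => _ [alpha /admissible2P[a [b [ab ->]]] <-].
  have [[-> ->]|] := cost2_lower_bound _ _ ab; first by rewrite optimum.
  by rewrite distortion_prob6 lee_fin => /ltW.
split=> // alpha; split=> [|->]; last by split=> //; rewrite V2.
case=> /admissible2P[a [b [ab ->]]]; rewrite V2 distortion_prob6 => -[costE].
(* Uniqueness: any other pair costs strictly more than 341/768, contradicting [costE]. *)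
have [[-> ->]//|] := cost2_lower_bound _ _ ab.
by rewrite costE ltxx.
Qed.
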